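(* Let $\Bbbk$ be a field, $R$ a positively $\mathbb{Z}^r$-graded polynomial ring over $\Bbbk$, $G$ a finite group whose order is not divisible by the characteristic of $\Bbbk$, and $M$ a finitely generated graded $R$-module, with compatible degree-preserving $\Bbbk$-linear actions of $G$ on $R$ and $M$. Let $(F_\bullet,d_\bullet)$ be a $G$-equivariant graded minimal free resolution of $M$ with chosen homogeneous $R$-bases $\mathcal{E}_i$ of $F_i$ as described in the context. For $g\in G$ let $\psi^g_i\colon F_i\to F_i$ be the $R$-linear map with $\psi^g_i(e)=ge$ for all $e\in\mathcal{E}_i$, and let $d^g_i=\psi^g_{i-1}\,d_i\,(\psi^g_i)^{-1}\colon F_i\to F_{i-1}$ for $i\geqslant 1$. Let $F_{i,j}$ be the free direct summand of $F_i$ generated by the elements of $\mathcal{E}_i$ of degree $j$, and $\pi_{i,j}\colon F_i\to F_{i,j}$ the natural projection. Then for every $g\in G$: if $\hat{\psi}^g_\bullet\colon (F_\bullet,d_\bullet)\to(F_\bullet,d^g_\bullet)$ is a (degree-preserving, $R$-linear) map of complexes with $\hat{\psi}^g_0=\psi^g_0$, then $$\pi_{i,j}\,\hat{\psi}^g_i(e)=ge=\psi^g_i(e)$$ for every $i\geqslant 0$, every $j\in\mathbb{Z}^r$ and every $e\in\mathcal{E}_i$ of degree $j$. In particular, the value at $g$ of the $(i,j)$-th Betti character, $\beta^G_{i,j}(M)(g)$, is equal to the trace of $\hat{\psi}^g_i$ restricted to degree $j$.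
   Context: Gradings: $R=\Bbbk[x_1,\dots,x_n]$ is $\mathbb{Z}^r$-graded with each variable homogeneous and elements of $\Bbbk$ of degree $0$; the grading is positive, meaning that there is a $\mathbb{Z}$-linear functional $\mathbb{Z}^r\to\mathbb{Z}$ taking a positive value on the degree of every variable (so in particular $R_0=\Bbbk$). The standard grading is an example. $\mathfrak{m}$ denotes the ideal generated by the variables and $\Bbbk=R/\mathfrak{m}$ as an $R$-module. Maps between graded modules (and maps of complexes of graded modules) are $R$-linear and degree-preserving. Group actions: $G$ acts $\Bbbk$-linearly and preserving degrees on $R$ and on $M$, with $g(rs)=(gr)(gs)$ and $g(rm)=(gr)(gm)$ for all $g\in G$, $r,s\in R$, $m\in M$. Resolution: $(F_\bullet,d_\bullet)$ is a graded minimal free resolution of $M$ by finitely generated free modules (minimal: $\operatorname{im} d_i\subseteq\mathfrak{m}F_{i-1}$ for $i\geqslant 1$), with augmentation $d_0\colon F_0\to M$. Each $F_i$ carries a degree-preserving $\Bbbk$-linear $G$-action with $g(rf)=(gr)(gf)$ for $r\in R$, $f\in F_i$, and all $d_i$ (including $d_0$) are $G$-equivariant. For each $i$, $\mathcal{E}_i$ is a homogeneous $R$-basis of $F_i$ such that $G$ sends every element of $\mathcal{E}_i$ of degree $j$ to a $\Bbbk$-linear combination of elements of $\mathcal{E}_i$ of degree $j$. With these conventions each $\psi^g_i$ is invertible, with $(\psi^g_i)^{-1}=\psi^{g^{-1}}_i$. Betti character: $\operatorname{Tor}^R_i(M,\Bbbk)_j\cong(F_i\otimes_R\Bbbk)_j$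 is a representation of $G$ via $g(f\otimes 1)=(gf)\otimes 1$. The $(i,j)$-th Betti character of $G$ on $M$, denoted $\beta^G_{i,j}(M)$, is the character of this representation, i.e. the function $G\to\Bbbk$ sending $g$ to the trace of the action of $g$ on $\operatorname{Tor}^R_i(M,\Bbbk)_j$. Trace restricted to degree $j$: for a degree-preserving $R$-linear map $\varphi\colon F_i\to F_i$, the trace of $\varphi$ restricted to degree $j$ is the trace of the submatrix of the matrix of $\varphi$ relative to $\mathcal{E}_i$ consisting of the rows and columns indexed by the elements of $\mathcal{E}_i$ of degree $j$ (the entries of this submatrix lie in $R_0=\Bbbk$). *)

(* Defs.v *)
From HB Require Import structures.
From mathcomp Require Import all_boot all_order fingroup all_algebra.
From mathcomp Require Import generic_quotient ring_quotient.
From mathcomp Require Import boolp.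
From mathcomp Require Import mpoly.

Set Implicit Arguments.
Unset Strict Implicit.
Unset Printing Implicit Defensive.

Import GRing.Theory.

Local Open Scope ring_scope.
Local Open Scope quotient_scope.

Section Gradings.

Variables (k : fieldType) (n r : nat).
Local Notation R := {mpoly k[n]}.

(* [w i] is the degree of the variable ['X_i]. *)
Variable w : 'I_n -> 'rV[int]_r.

Definition mondeg (m : 'X_{1..n}) : 'rV[int]_r := \sum_(i < n) w i *+ m i.

Definition poly_homog (j : 'rV[int]_r) (p : R) : Prop :=
  forall m, m \in msupp p -> mondeg m = j.

Definition positive_grading : Prop :=
  exists L : {additive 'rV[int]_r -> int}, forall i, (0 < L (w i))%R.

(* [hom_part j] is the degree-[j] component; the last two fields say that the
   module is the direct sum of its components. *)
Record grading (M : lmodType R) := Grading {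
  hom_part :> 'rV[int]_r -> M -> Prop;
  hom_part0 : forall j, hom_part j 0;
  hom_partB : forall j x y, hom_part j x -> hom_part j y -> hom_part j (x - y);
  hom_partZ : forall a j p x,
    poly_homog a p -> hom_part j x -> hom_part (a + j) (p *: x);
  hom_part_span : forall x, exists (s : seq 'rV[int]_r) (c : 'rV[int]_r -> M),
    (forall j, hom_part j (c j)) /\ x = \sum_(j <- s) c j;
  hom_part_direct : forall (s : seq 'rV[int]_r) (c : 'rV[int]_r -> M),
    uniq s -> (forall j, hom_part j (c j)) -> \sum_(j <- s) c j = 0 ->
    forall j, j \in s -> c j = 0 }.

Definition degree_preserving (M N : lmodType R) (gM : grading M)
    (gN : grading N) (f : M -> N) : Prop :=
  forall j x, gM j x -> gN j (f x).

Definition fin_generated (M : lmodType R) : Prop :=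
  exists (N : nat) (v : 'I_N -> M),
    forall x, exists c : 'I_N -> R, x = \sum_(a < N) c a *: v a.

Record basis (F : lmodType R) := Basis {
  bidx : finType;
  bvec : bidx -> F;
  bcoord : F -> bidx -> R;
  bcoordK : forall f, \sum_x bcoord f x *: bvec x = f;
  bvecK : forall (c : bidx -> R) y, bcoord (\sum_x c x *: bvec x) y = c y }.

Record hom_basis (F : lmodType R) (gF : grading F) := HomBasis {
  hbasis :> basis F;
  bdeg : bidx hbasis -> 'rV[int]_r;
  bdegP : forall x, gF (bdeg x) (bvec x) }.

(* The [R]-linear map sending each basis element [bvec x] to [v x]. *)
Definition lin_ext (F N : lmodType R) (B : basis F) (v : bidx B -> N) (f : F) :
  N := \sum_x bcoord f x *: v x.

(* The projection of [F] onto the free summand generated by the basis elements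
   of degree [j], this summand being regarded as a submodule of [F]. *)
Definition deg_proj (F : lmodType R) (gF : grading F) (E : hom_basis gF)
    (j : 'rV[int]_r) (f : F) : F :=
  \sum_(x : bidx E | bdeg x == j) bcoord f x *: bvec x.

(* A priori an element of [R]: its summands are diagonal entries of the matrix
   of [phi] relative to [E]. *)
Definition deg_trace (F : lmodType R) (gF : grading F) (E : hom_basis gF)
    (j : 'rV[int]_r) (phi : F -> F) : R :=
  \sum_(x : bidx E | bdeg x == j) bcoord (phi (bvec x)) x.

End Gradings.

Section Actions.

Variables (k : fieldType) (n r : nat) (w : 'I_n -> 'rV[int]_r).
Variable gT : finGroupType.
Local Notation R := {mpoly k[n]}.

(* Left actions, as opposed to the right actions of MathComp. *)
Record ring_action (actR : gT -> R -> R) : Prop := RingAction {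
  ractA : forall g h p, actR (g * h)%g p = actR g (actR h p);
  ract1 : forall p, actR 1%g p = p;
  ract_linear : forall g (c : k) p q,
    actR g (c *: p + q) = c *: actR g p + actR g q;
  ractM : forall g p q, actR g (p * q) = actR g p * actR g q;
  ract_deg : forall g j p, poly_homog w j p -> poly_homog w j (actR g p) }.

Record module_action (actR : gT -> R -> R) (M : lmodType R) (gM : grading w M)
    (act : gT -> M -> M) : Prop := ModuleAction {
  mactA : forall g h x, act (g * h)%g x = act g (act h x);
  mact1 : forall x, act 1%g x = x;
  mact_linear : forall g (c : k) x y,
    act g (c%:MP *: x + y) = c%:MP *: act g x + act g y;
  mactZ : forall g p x, act g (p *: x) = actR g p *: act g x;
  mact_deg : forall g, degree_preserving gM gM (act g) }.

Definition basis_stable (F : lmodType R) (gF : grading w F) (E : hom_basis gF)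
    (act : gT -> F -> F) : Prop :=
  forall g (x : bidx E), exists c : bidx E -> k,
    act g (bvec x) = \sum_(y : bidx E | bdeg y == bdeg x) (c y)%:MP *: bvec y.

End Actions.

Section TensorResidue.

Variables (k : fieldType) (n : nat).
Local Notation R := {mpoly k[n]}.

(* Membership in [m F], where [m] is the ideal generated by the variables. *)
Definition in_mF (F : lmodType R) (f : F) : Prop :=
  exists h : 'I_n -> F, f = \sum_(i < n) 'X_i *: h i.

Definition mF (F : lmodType R) : {pred F} := fun f => `[< in_mF f >].
Arguments mF : clear implicits.

Fact mF_zmod_closed (F : lmodType R) : zmod_closed (mF F).
Proof.
split=> [|x y /asboolP[h ->] /asboolP[h' ->]]; apply/asboolP.
  by exists (fun=> 0); rewrite big1 // => i _; rewrite scaler0.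
exists (fun i => h i - h' i); rewrite -sumrB.
by apply: eq_bigr => i _; rewrite scalerBr.
Qed.

HB.instance Definition _ (F : lmodType R) :=
  GRing.isZmodClosed.Build F (mF F) (mF_zmod_closed F).

(* [F (x)_R k], realised as [F / m F]; see [tensk_universal]. *)
Definition tensk (F : lmodType R) : Type := {ideal_quot (mF F)}.

HB.instance Definition _ (F : lmodType R) := GRing.Zmodule.on (tensk F).
HB.instance Definition _ (F : lmodType R) := EqQuotient.on (tensk F).

(* The pure tensor [f (x) 1]. *)
Definition pure (F : lmodType R) (f : F) : tensk F := \pi_(tensk F) f.

Lemma pure_eq (F : lmodType R) (f f' : F) :
  pure f = pure f' <-> in_mF (f - f').
Proof.
rewrite /pure; split=> [/eqP|H].
  by rewrite -Quotient.idealrBE => /asboolP.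
by apply/eqP; rewrite -Quotient.idealrBE; apply/asboolP.
Qed.

Lemma pureB (F : lmodType R) : {morph @pure F : x y / x - y}.
Proof. by move=> x y; rewrite /pure Quotient.pi_add Quotient.pi_opp. Qed.

Lemma pureD (F : lmodType R) : {morph @pure F : x y / x + y}.
Proof. by move=> x y; rewrite /pure Quotient.pi_add. Qed.

Lemma pure_repr (F : lmodType R) (t : tensk F) : pure (repr t) = t.
Proof. exact: reprK. Qed.

Lemma in_mFZ (F : lmodType R) (p : R) (f : F) : in_mF f -> in_mF (p *: f).
Proof.
case=> h ->; exists (fun i => p *: h i); rewrite scaler_sumr.
by apply: eq_bigr => i _; rewrite !scalerA mulrC.
Qed.

Definition tensk_scale (F : lmodType R) (p : R) (t : tensk F) : tensk F :=
  pure (p *: repr t).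

Lemma tensk_scaleE (F : lmodType R) p (f : F) :
  tensk_scale p (pure f) = pure (p *: f).
Proof.
apply/pure_eq; rewrite -scalerBr; apply: in_mFZ.
by apply/pure_eq; rewrite pure_repr.
Qed.

Section Scale.
Variable F : lmodType R.

Fact tensk_scaleA p q (t : tensk F) :
  tensk_scale p (tensk_scale q t) = tensk_scale (p * q) t.
Proof. by rewrite -[t]pure_repr !tensk_scaleE scalerA. Qed.

Fact tensk_scale1 : left_id 1 (@tensk_scale F).
Proof. by move=> t; rewrite -[t]pure_repr tensk_scaleE scale1r. Qed.

Fact tensk_scaleDr : right_distributive (@tensk_scale F) +%R.
Proof.
move=> p t u; rewrite -[t]pure_repr -[u]pure_repr -pureD !tensk_scaleE.
by rewrite -pureD scalerDr.
Qed.

Fact tensk_scaleDl (t : tensk F) : {morph (@tensk_scale F)^~ t : p q / p + q}.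
Proof.
by move=> p q; rewrite -[t]pure_repr !tensk_scaleE -pureD scalerDl.
Qed.

HB.instance Definition _ := GRing.Zmodule_isLmodule.Build R (tensk F)
  tensk_scaleA tensk_scale1 tensk_scaleDr tensk_scaleDl.

End Scale.

Lemma pureZ (F : lmodType R) p (f : F) : pure (p *: f) = p *: pure f.
Proof. by rewrite -tensk_scaleE. Qed.

(* The [R]-module [k = R/m]. *)
Definition residue : Type := k.

HB.instance Definition _ := GRing.Zmodule.on residue.

Definition residue_scale (p : R) (c : residue) : residue := p@_0%MM * c.

Fact residue_scaleA p q (c : residue) :
  residue_scale p (residue_scale q c) = residue_scale (p * q) c.
Proof. by rewrite /residue_scale mulrA rmorphM. Qed.

Fact residue_scale1 : left_id 1 residue_scale.
Proof. by move=> c; rewrite /residue_scale rmorph1 mul1r. Qed.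

Fact residue_scaleDr : right_distributive residue_scale +%R.
Proof. by move=> p c c'; rewrite /residue_scale mulrDr. Qed.

Fact residue_scaleDl c : {morph residue_scale^~ c : p q / p + q}.
Proof. by move=> p q; rewrite /residue_scale rmorphD mulrDl. Qed.

HB.instance Definition _ := GRing.Zmodule_isLmodule.Build R residue
  residue_scaleA residue_scale1 residue_scaleDr residue_scaleDl.

Definition bilinear_map (M N P : lmodType R) (b : M -> N -> P) : Prop :=
  (forall y, linear (b^~ y)) /\ (forall x, linear (b x)).

Definition is_tensor_product (M N T : lmodType R) (tau : M -> N -> T) : Prop :=
  bilinear_map tau /\
  forall (P : lmodType R) (b : M -> N -> P), bilinear_map b ->
    exists h : {linear T -> P}, (forall x y, h (tau x y) = b x y) /\
      forall h' : {linear T -> P}, (forall x y, h' (tau x y) = b x y) ->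
        h' =1 h.

Fact in_m_sub0 (p : R) : in_mF ((p@_0%MM)%:MP - p : R^o).
Proof.
apply/asboolP; rewrite -[`[< _ >]]/((_ : R^o) \in mF R^o).
elim/mpolyind: p => [|c m p _ _ IHp]; first by rewrite mcoeff0 subr0 rpred0.
rewrite mcoeffD mpolyCD opprD addrACA; apply: rpredD => //.
rewrite mcoeffZ mcoeffX; have [->|m_neq0] := eqVneq m 0%MM.
  by rewrite mulr1 mpolyX0 alg_mpolyC subrr rpred0.
rewrite mulr0 mpolyC0 sub0r rpredN; apply/asboolP.
rewrite -mul_mpolyC.
have [i m_i] : exists i, m i != 0%N.
  apply/existsP; apply: contraNT m_neq0; rewrite negb_exists => /forallP m0.
  by apply/eqP/mnmP => i; rewrite mnm0E; apply/eqP; rewrite -[_ == _]negbK m0.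
exists (fun i' => if i' == i then c%:MP * 'X_[m - U_(i)] else 0).
rewrite (bigD1 i) //= eqxx big1 ?addr0 => [|i' /negPf->]; last by rewrite scaler0.
rewrite -[in LHS](submK (m := U_(i)) (m' := m)) ?lep1mP // mpolyXD.
by rewrite mulrA mulrC.
Qed.

(* The tensor [f (x) c] is the class of [c f]. *)
Lemma tensk_universal (F : lmodType R) :
  @is_tensor_product F residue (tensk F) (fun f c => pure (c%:MP *: f)).
Proof.
split.
  split=> [c p x y|f p c c'] /=.
    by rewrite scalerDr pureD scalerA mulrC -scalerA pureZ.
  rewrite -pureZ -pureD scalerA -scalerDl; apply/pure_eq.
  rewrite -scalerBl; have -> : (p *: c + c')%:MP - (p * c%:MP + c'%:MP) =
      ((p@_0%MM)%:MP - p) * c%:MP :> R.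
    by rewrite mpolyCD mpolyCM mulrBl opprD addrACA subrr addr0.
  rewrite mulrC -scalerA; apply: in_mFZ; have [h ->] := in_m_sub0 p.
  exists (fun i => (h i : R) *: f); rewrite scaler_suml.
  by apply: eq_bigr => i _; rewrite scalerA.
move=> P b [b_l b_r].
pose b1 : {linear F -> P} :=
  HB.pack (b^~ 1) (GRing.isLinear.Build R F P *:%R (b^~ 1) (b_l 1)).
pose bf f : {linear residue -> P} :=
  HB.pack (b f) (GRing.isLinear.Build R residue P *:%R (b f) (b_r f)).
have b1_m f : in_mF f -> b1 f = 0.
  case=> h ->; rewrite linear_sum big1 // => i _; rewrite linearZ.
  rewrite -[b1 _]/(bf (h i) 1) -linearZ /=.
  suff -> : 'X_i *: (1 : residue) = 0 by exact: (linear0 (bf (h i))).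
  rewrite -[LHS]/('X_i@_0%MM * 1) mulr1 mcoeffX.
  by case: eqP => // /mnmP/(_ i); rewrite mnm1E eqxx mnm0E.
have b1E f : b1 (repr (pure f)) = b1 f.
  apply/eqP; rewrite -subr_eq0 -linearB; apply/eqP/b1_m.
  by apply/pure_eq; rewrite pure_repr.
pose h (t : tensk F) := b1 (repr t).
have h_linear : linear h.
  move=> p t u; rewrite -[t]pure_repr -[u]pure_repr -pureZ -pureD /h !b1E.
  exact: linearP.
pose hl : {linear tensk F -> P} :=
  HB.pack h (GRing.isLinear.Build R (tensk F) P *:%R h h_linear).
have hE f c : h (pure (c%:MP *: f)) = b f c.
  rewrite /h b1E linearZ -[b1 f]/(bf f 1) -linearZ /=; congr (bf f _).
  by rewrite -[LHS]/((c%:MP : R)@_0%MM * 1) mcoeffC eqxx !mulr1.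
exists hl; split=> [|h' h'E t]; first exact: hE.
by rewrite -[t]pure_repr -[repr t]scale1r -mpolyC1 h'E [RHS]hE.
Qed.

Definition tensk_map (F F' : lmodType R) (phi : F -> F') (t : tensk F) :
  tensk F' := pure (phi (repr t)).

Lemma tensk_mapE (F F' : lmodType R) (phi : F -> F') :
    {morph phi : x y / x - y} -> (forall f, in_mF f -> in_mF (phi f)) ->
  forall f, tensk_map phi (pure f) = pure (phi f).
Proof.
move=> phiB phim f; apply/pure_eq; rewrite -phiB; apply: phim.
by apply/pure_eq; rewrite pure_repr.
Qed.

End TensorResidue.

Section Trace.

Variables (k : fieldType) (n : nat).
Local Notation R := {mpoly k[n]}.
Variables (T : lmodType R) (V W : T -> Prop).

(* For [k]-subspaces [W] and [V] of [T] with [W] contained in [V]: the family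
   [v] in [V] is a [k]-basis of [V / W]. *)
Definition is_basis_mod (N : nat) (v : 'I_N -> T) : Prop :=
  (forall a, V (v a)) /\
  forall t, V t -> exists! c : 'rV[k]_N,
    W (t - \sum_(a < N) (c 0 a)%:MP *: v a).

Definition is_trace_mod (phi : T -> T) (t : k) : Prop :=
  exists (N : nat) (v : 'I_N -> T) (A : 'M[k]_N),
    [/\ is_basis_mod v,
        forall a, W (phi (v a) - \sum_(b < N) (A b a)%:MP *: v b)
      & t = \tr A].

(* The trace of the [k]-linear endomorphism of [V / W] induced by [phi]. *)
Definition trace_mod (phi : T -> T) : k :=
  if pselect (exists t, is_trace_mod phi t) is left h then sval (cid h) else 0.

End Trace.

Section Resolutions.

Variables (k : fieldType) (n r : nat) (w : 'I_n -> 'rV[int]_r).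
Local Notation R := {mpoly k[n]}.
Variables (M : lmodType R) (gM : grading w M).
Variables (F : nat -> lmodType R) (gF : forall i, grading w (F i)).
(* [d i] is the differential from [F i.+1] to [F i], i.e. d_(i+1) in the usual
   indexing; [eps] is the augmentation d_0. *)
Variables (d : forall i, {linear F i.+1 -> F i}) (eps : {linear F 0%N -> M}).

Record minimal_resolution : Prop := MinimalResolution {
  res_d_deg : forall i, degree_preserving (gF i.+1) (gF i) (d i);
  res_eps_deg : degree_preserving (gF 0%N) gM eps;
  res_eps_surj : forall x, exists f, eps f = x;
  res_exact0 : forall f, eps f = 0 <-> exists h, f = d 0%N h;
  res_exact : forall i f, d i f = 0 <-> exists h, f = d i.+1 h;
  res_minimal : forall i f, in_mF (d i f) }.

(* [Tor_i(M, k)_j] is the degree-[j] part of the homology of the complex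
   [F (x) k], i.e. the quotient of [tor_cycle i j] by [tor_boundary i j]. *)
Definition tensk_hom (i : nat) (j : 'rV[int]_r) (t : tensk (F i)) : Prop :=
  exists f, gF i j f /\ t = pure f.

Definition tor_cycle (i : nat) (j : 'rV[int]_r) (t : tensk (F i)) : Prop :=
  tensk_hom j t /\
  match i return tensk (F i) -> Prop with
  | 0%N => fun=> True
  | i'.+1 => fun t => tensk_map (d i') t = 0
  end t.

Definition tor_boundary (i : nat) (j : 'rV[int]_r) (t : tensk (F i)) : Prop :=
  tensk_hom j t /\ exists u : tensk (F i.+1), t = tensk_map (d i) u.

(* The [G]-action on [Tor] is induced by [g (f (x) 1) = g f (x) 1]. *)
Definition betti_character (gT : finGroupType)
    (actF : forall i, gT -> F i -> F i) (i : nat) (j : 'rV[int]_r) (g : gT) : k :=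
  trace_mod (@tor_cycle i j) (@tor_boundary i j) (tensk_map (actF i g)).

End Resolutions.

(* The two-sided inverse of [f] when [f] is bijective. *)
Definition inverse_map (U V : zmodType) (f : U -> V) (y : V) : U :=
  if pselect (exists x, f x = y) is left h then sval (cid h) else 0.

Lemma inverse_mapP (U V : zmodType) (f : U -> V) :
  bijective f -> cancel f (inverse_map f) /\ cancel (inverse_map f) f.
Proof.
case=> h fK hK; have K : cancel (inverse_map f) f.
  move=> y; rewrite /inverse_map; case: pselect => [e|[]].
    exact: (svalP (cid e)).
  by exists (h y).
by split=> // x; apply: (can_inj fK); rewrite K.
Qed.

Section Twist.

Variables (k : fieldType) (n r : nat) (w : 'I_n -> 'rV[int]_r).
Local Notation R := {mpoly k[n]}.
Variables (F : nat -> lmodType R) (gF : forall i, grading w (F i)).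
Variables (d : forall i, {linear F i.+1 -> F i}).
Variables (E : forall i, hom_basis (gF i)).
Variables (gT : finGroupType) (actF : forall i, gT -> F i -> F i).
Arguments actF : clear implicits.

(* The maps psi^g_i and d^g_(i+1). *)
Definition psi (g : gT) (i : nat) : F i -> F i :=
  lin_ext (fun x : bidx (E i) => actF i g (bvec x)).
Arguments psi : clear implicits.

Definition twisted_d (g : gT) (i : nat) : F i.+1 -> F i :=
  psi g i \o d i \o inverse_map (psi g i.+1).

End Twist.
Arguments psi {k n r w F gF} E {gT} actF g i.
Arguments twisted_d {k n r w F gF} d E {gT} actF g i.
Arguments betti_character {k n r w F} gF d {gT} actF i j g.

(* Main.v *)
(** Put [theta = (psi^g)^-1 psihat^g].  It is an endomorphism of the minimal
    resolution [F] over the identity of [M], hence homotopic to the identity;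
    since [d] maps into [m F], both terms of the homotopy formula do, and
    [theta] is the identity modulo [m F].  So [psihat^g e - psi^g e] lies in
    [m F] and is homogeneous of the degree [j] of [e]: its coordinates on basis
    elements of degree [j] have degree [0], are therefore constants, and being
    in [m] they vanish.  On the other hand, minimality identifies
    [Tor_i(M, k)_j] with the degree-[j] part of [F_i / m F_i], on which the
    classes of the basis elements of degree [j] form a [k]-basis. *)

Require Import Defs.
From HB Require Import structures.
From mathcomp Require Import all_boot all_order fingroup all_algebra.
From mathcomp Require Import boolp.
From mathcomp Require Import mpoly.

Set Implicit Arguments.
Unset Strict Implicit.
Unset Printing Implicit Defensive.

Import Order.TTheory GRing.Theory Num.Theory.

Local Open Scope ring_scope.

(** * Closure properties of [m F] and the quotient map onto [F / m F] *)

Section ResidueSubmodule.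

Variables (k : fieldType) (n : nat).
Local Notation R := {mpoly k[n]}.

Lemma in_mFD (F : lmodType R) (f f' : F) :
  in_mF f -> in_mF f' -> in_mF (f + f').
Proof.
move=> Hf Hf'; apply/asboolP; rewrite -[`[< _ >]]/(f + f' \in @mF _ _ F).
by apply: rpredD; apply/asboolP.
Qed.

Lemma in_mF_sum (F : lmodType R) (I : Type) (s : seq I) (P : pred I)
    (f : I -> F) :
  (forall x, P x -> in_mF (f x)) -> in_mF (\sum_(x <- s | P x) f x).
Proof.
move=> Hf; apply/asboolP; rewrite -[`[< _ >]]/(_ \in @mF _ _ F).
by apply: rpred_sum => x Px; apply/asboolP/Hf.
Qed.

Lemma in_mF_linear (F F' : lmodType R) (h : {linear F -> F'}) f :
  in_mF f -> in_mF (h f).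
Proof.
case=> a ->; exists (h \o a); rewrite linear_sum.
by apply: eq_bigr => i _; rewrite linearZ.
Qed.

(** By [in_m_sub0], [p] differs from its constant term by an element of [m]. *)
Lemma in_mF_poly (F : lmodType R) (p : R) (f : F) :
  p@_0%MM = 0 -> in_mF (p *: f).
Proof.
move=> p0; have [h] := in_m_sub0 p; rewrite p0 mpolyC0 sub0r => pE.
exists (fun i => - (h i : R) *: f); rewrite -[p]opprK pE scaleNr.
rewrite scaler_suml -sumrN.
by apply: eq_bigr => i _; rewrite scaleNr scalerN scalerA.
Qed.

Lemma pure0 (F : lmodType R) : pure (0 : F) = 0.
Proof. by rewrite -[0 in LHS](subrr 0) pureB subrr. Qed.

Lemma pure0P (F : lmodType R) (f : F) : pure f = 0 <-> in_mF f.
Proof. by rewrite -(pure0 F) pure_eq subr0. Qed.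

Lemma pure_sum (F : lmodType R) (I : Type) (s : seq I) (P : pred I)
    (f : I -> F) :
  pure (\sum_(x <- s | P x) f x) = \sum_(x <- s | P x) pure (f x).
Proof. exact: (big_morph _ (@pureD _ _ _) (pure0 F)). Qed.

End ResidueSubmodule.

(** * Coordinates and linear maps on a free module *)

Section Bases.

Variables (k : fieldType) (n : nat).
Local Notation R := {mpoly k[n]}.
Variables (F : lmodType R) (B : Defs.basis F).

(** The arguments of [bcoord] are swapped so that each coordinate function can carry a linear
    structure. *)
Definition bcoord_of (x : bidx B) (f : F) : R := bcoord f x.

Fact bcoord_of_linear (x : bidx B) : linear_for *%R (bcoord_of x).
Proof.
move=> p f f'; rewrite /bcoord_of -{1}[f](bcoordK B) -{1}[f'](bcoordK B).
rewrite scaler_sumr -big_split.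
under eq_bigr do rewrite /= scalerA -scalerDl.
by rewrite bvecK.
Qed.

HB.instance Definition _ (x : bidx B) :=
  GRing.isLinear.Build R F R *%R (bcoord_of x) (bcoord_of_linear x).

Lemma bcoordZ p f (x : bidx B) : bcoord (p *: f) x = p * bcoord f x.
Proof. by rewrite -[LHS]/(bcoord_of x _) linearZ. Qed.

Lemma bcoordB f f' (x : bidx B) : bcoord (f - f') x = bcoord f x - bcoord f' x.
Proof. exact: (linearB (bcoord_of x)). Qed.

Lemma bcoord_sum (I : Type) (s : seq I) (P : pred I) (f : I -> F) (x : bidx B) :
  bcoord (\sum_(a <- s | P a) f a) x = \sum_(a <- s | P a) bcoord (f a) x.
Proof. exact: (linear_sum (bcoord_of x)). Qed.

Lemma bcoord_bvec (x y : bidx B) : bcoord (bvec x) y = (x == y)%:R.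
Proof.
rewrite -[bvec x](_ : \sum_z (x == z)%:R *: bvec z = _) ?bvecK //.
rewrite (bigD1 x) //= eqxx scale1r big1 ?addr0 // => z.
by rewrite eq_sym => /negPf->; rewrite scale0r.
Qed.

Lemma bcoord_in_mF f (x : bidx B) : in_mF f -> (bcoord f x)@_0%MM = 0.
Proof.
case=> h ->; rewrite bcoord_sum raddf_sum /= big1 // => i _.
rewrite bcoordZ rmorphM /= mcoeffX.
by case: eqP => [/mnmP/(_ i)|]; rewrite ?mnm1E ?eqxx ?mnm0E ?mul0r.
Qed.

Lemma lin_ext_linear (N : lmodType R) (v : bidx B -> N) : linear (lin_ext v).
Proof.
move=> p f f'; rewrite /lin_ext scaler_sumr -big_split; apply: eq_bigr => x _.
by rewrite -[bcoord _ x]/(bcoord_of x _) linearP scalerDl scalerA.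
Qed.

HB.instance Definition _ (N : lmodType R) (v : bidx B -> N) :=
  GRing.isLinear.Build R F N *:%R (lin_ext v) (lin_ext_linear v).

Lemma lin_ext_bvec (N : lmodType R) (v : bidx B -> N) x :
  lin_ext v (bvec x) = v x.
Proof.
rewrite /lin_ext (bigD1 x) //= big1 => [|y yx]; rewrite bcoord_bvec.
  by rewrite eqxx scale1r addr0.
by rewrite eq_sym (negPf yx) scale0r.
Qed.

Lemma linear_ext (N : lmodType R) (u v : {linear F -> N}) :
  (forall x : bidx B, u (bvec x) = v (bvec x)) -> u =1 v.
Proof.
move=> uv f; rewrite -[f](bcoordK B) !linear_sum; apply: eq_bigr => x _.
by rewrite !linearZ /= uv.
Qed.

(** Projectivity of free modules: choose a preimage for each basis vector and extend linearly. *)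
Lemma linear_lift (N P : lmodType R) (u : {linear F -> N})
    (q : {linear P -> N}) :
    (forall f, exists h, u f = q h) ->
  exists h : {linear F -> P}, forall f, u f = q (h f).
Proof.
move=> uq; have [v vE] := choice (fun x : bidx B => uq (bvec x)).
exists (lin_ext v) => f; apply: (linear_ext (v := q \o lin_ext v)) => x /=.
by rewrite lin_ext_bvec.
Qed.

End Bases.

(** * A lift of the identity to a minimal resolution is the identity modulo [m] *)

Section Homotopy.

Variables (k : fieldType) (n : nat).
Local Notation R := {mpoly k[n]}.
Variables (M : lmodType R) (F : nat -> lmodType R).
Variables (d : forall i, {linear F i.+1 -> F i}) (eps : {linear F 0%N -> M}).
Hypothesis F_free : forall i, inhabited (Defs.basis (F i)).
Hypothesis exact0 : forall f, eps f = 0 <-> exists h, f = d 0%N h.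
Hypothesis exactS : forall i f, d i f = 0 <-> exists h, f = d i.+1 h.
Hypothesis d_minimal : forall i f, in_mF (d i f).
Variable th : forall i, {linear F i -> F i}.
Hypothesis th_chain : forall i f, th i (d i f) = d i (th i.+1 f).
Hypothesis th_eps : forall f, eps (th 0%N f) = eps f.

(* [h] is the component of a homotopy from the identity to [th]; the second
   equation is all that its next component needs. *)
Lemma lift_id_homotopy i : exists h : {linear F i -> F i.+1},
  (forall f, in_mF (th i f - f)) /\
  (forall f, th i (d i f) - d i f = d i (h (d i f))).
Proof.
elim: i => [|i [h [_ hE]]].
  have [B] := F_free 0; pose u : {linear F 0%N -> F 0%N} := th 0%N \- idfun.
  have [h hE] : exists h : {linear F 0%N -> F 1%N}, forall f, u f = d 0%N (h f).
    apply: (linear_lift B) => f; apply/exact0.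
    by rewrite linearB /= th_eps subrr.
  by exists h; split=> f; [rewrite -[th _ _ - _]/(u f) hE | exact: hE].
have [B] := F_free i.+1.
(* By the chain property and the equation for [h], this map has image in the kernel of [d i];
   exactness then lets it lift through [d i.+1]. *)
pose u : {linear F i.+1 -> F i.+1} := (th i.+1 \- idfun) \- (h \o d i).
have [h' h'E] : exists h' : {linear F i.+1 -> F i.+2},
    forall f, u f = d i.+1 (h' f).
  apply: (linear_lift B) => f; apply/exactS.
  by rewrite !linearB /= -th_chain hE subrr.
have thE f : th i.+1 f - f = d i.+1 (h' f) + h (d i f).
  by rewrite -h'E /= subrK.
exists h'; split=> f; rewrite thE.
  by apply: in_mFD => //; apply: in_mF_linear.
have -> : d i (d i.+1 f) = 0 by apply/exactS; exists f.
by rewrite linear0 addr0.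
Qed.

Lemma lift_id_mod_m i f : in_mF (th i f - f).
Proof. by have [h []] := lift_id_homotopy i. Qed.

End Homotopy.

(** * Homogeneous polynomials and homogeneous coordinates *)

Section Graded.

Variables (k : fieldType) (n r : nat) (w : 'I_n -> 'rV[int]_r).
Local Notation R := {mpoly k[n]}.

Lemma mondeg0 : mondeg w 0%MM = 0.
Proof. by rewrite /mondeg big1 // => i _; rewrite mnm0E mulr0n. Qed.

Lemma mondeg_mnm1 i : mondeg w U_(i)%MM = w i.
Proof.
rewrite /mondeg (bigD1 i) //= mnm1E eqxx mulr1n big1 ?addr0 // => i' i'i.
by rewrite mnm1E eq_sym (negPf i'i) mulr0n.
Qed.

(** The functional [L] turns the degree of [m] into a sum of nonnegative integers, so each summand
    [L (w i) *+ m i] vanishes, while [L (w i)] is positive. *)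
Lemma mondeg_eq0 m : positive_grading w -> mondeg w m = 0 -> m = 0%MM.
Proof.
case=> L Lw wm; apply/mnmP => i; rewrite mnm0E.
have term_ge0 i' : 0 <= L (w i' *+ m i') by rewrite raddfMn mulrn_wge0 ?ltW.
have /psumr_eq0P : \sum_(i' < n) L (w i' *+ m i') = 0.
  by rewrite -raddf_sum -[X in L X]/(mondeg w m) wm raddf0.
move=> /(_ (fun i' _ => term_ge0 i') i isT) /eqP.
by rewrite raddfMn mulrn_eq0 (gt_eqF (Lw i)) orbF => /eqP.
Qed.

Lemma poly_homog_mcoeff0 j (p : R) :
  poly_homog w j p -> j != 0 -> p@_0%MM = 0.
Proof.
move=> pj; apply: contra_neq_eq; rewrite -mcoeff_msupp => /pj <-.
exact: mondeg0.
Qed.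

Lemma poly_homog0C (p : R) :
  positive_grading w -> poly_homog w 0 p -> p = (p@_0%MM)%:MP.
Proof.
move=> w_pos p0; apply/mpolyP => m; rewrite mcoeffC.
have [->|m_neq0] := eqVneq 0%MM m; first by rewrite mulr1.
rewrite mulr0; apply: memN_msupp_eq0; apply: contra_neqN m_neq0 => /p0.
by move/(mondeg_eq0 w_pos).
Qed.

Lemma poly_homogX i : poly_homog w (w i) ('X_i : R).
Proof. by move=> m; rewrite msuppX inE => /eqP->; rewrite mondeg_mnm1. Qed.

Section Coordinates.

Variables (F : lmodType R) (gF : grading w F).

Lemma hom_part_sum j (I : Type) (s : seq I) (P : pred I) (f : I -> F) :
  (forall a, P a -> gF j (f a)) -> gF j (\sum_(a <- s | P a) f a).
Proof.
move=> fP; elim/big_rec: _ => [|a x Pa jx]; first exact: hom_part0.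
(* Components are only given as closed under subtraction, so the sum is written as
   [0 - ((0 - f a) - x)]. *)
rewrite -[f a]opprK addrC -opprB; have := hom_part0 gF j => j0.
rewrite -[- _ ]sub0r; apply: hom_partB => //; rewrite -[- f a]sub0r.
by apply: hom_partB => //; apply: hom_partB => //; apply: fP.
Qed.

Variable E : hom_basis gF.

(** Expand [f] into terms, a scalar times a monomial times a basis vector, and group them by total
    degree into the pieces [comp a]. Directness of the grading forces [f = comp j], whose
    coordinates are visibly homogeneous. *)
Lemma bcoord_homog j f (x : bidx E) :
  gF j f -> poly_homog w (j - bdeg x) (bcoord f x).
Proof.
move=> fj.
pose dg (y : bidx E) m := mondeg w m + bdeg y.
pose term (y : bidx E) m : F := ((bcoord f y)@_m *: 'X_[m]) *: bvec y.
pose comp a := \sum_y \sum_(m <- msupp (bcoord f y) | dg y m == a) term y m.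
(* All the degrees that occur, without repetition; [j] is added because it might not occur among
   them. *)
pose D := undup (j :: flatten [seq [seq dg y m | m <- msupp (bcoord f y)] |
  y <- enum (bidx E)]).
have comp_a a : gF a (comp a).
  apply: hom_part_sum => y _; apply: hom_part_sum => m /eqP <-.
  apply: hom_partZ (bdegP y) => m'; move/msuppZ_le; rewrite msuppX inE.
  by move/eqP->.
have fE : f = \sum_(a <- D) comp a.
  rewrite exchange_big /= -{1}[f](bcoordK E); apply: eq_bigr => y _.
  rewrite {1}[bcoord f y]mpolyE scaler_suml.
  under [RHS]eq_bigr do rewrite big_mkcond.
  rewrite exchange_big /=; apply: eq_big_seq => m m_y.
  have m_D : dg y m \in D.
    rewrite mem_undup inE; apply/orP; right; apply/flatten_mapP; exists y.
      by rewrite mem_enum.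
    by apply/mapP; exists m.
  rewrite (bigD1_seq (dg y m)) ?undup_uniq //= eqxx big1 ?addr0 // => a.
  by rewrite eq_sym => /negPf->.
have f_comp : f = comp j.
  apply/eqP; rewrite eq_sym -subr_eq0; apply/eqP.
  (* A homogeneous family summing to zero over [D], to which directness applies. *)
  pose c a := comp a - (if a == j then f else 0).
  have -> : comp j - f = c j by rewrite /c eqxx.
  have j_D : j \in D by rewrite mem_undup inE eqxx.
  apply: (@hom_part_direct _ _ _ _ _ gF D c) => //; first exact: undup_uniq.
    move=> a; apply: hom_partB => //; case: eqP => [->//|_].
    exact: hom_part0.
  rewrite sumrB -fE (bigD1_seq j) ?undup_uniq //= eqxx big1 ?addr0 ?subrr //.
  by move=> a /negPf->.
move=> m; rewrite mcoeff_msupp; apply: contra_neq_eq => deg_m.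
rewrite f_comp /comp; under eq_bigr do rewrite -scaler_suml.
rewrite bvecK raddf_sum /= big1 // => m' /eqP m'_deg.
rewrite mcoeffZ mcoeffX; case: eqP => [m'm|]; last by rewrite mulr0.
by case/eqP: deg_m; rewrite -m'_deg /dg m'm addrK.
Qed.

Lemma bcoord_hom_mcoeff0 j f (x : bidx E) :
  gF j f -> bdeg x != j -> (bcoord f x)@_0%MM = 0.
Proof.
move=> fj xj; apply: (poly_homog_mcoeff0 (bcoord_homog (x := x) fj)).
by rewrite subr_eq0 eq_sym.
Qed.

Lemma bcoord_homC j f (x : bidx E) : positive_grading w ->
  gF j f -> bdeg x = j -> bcoord f x = ((bcoord f x)@_0%MM)%:MP.
Proof.
move=> w_pos fj xj; apply: poly_homog0C => //.
by rewrite -(subrr j) -{2}xj; apply: bcoord_homog.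
Qed.

Lemma bcoord_deg_proj j f (x : bidx E) :
  bcoord (deg_proj E j f) x = if bdeg x == j then bcoord f x else 0.
Proof.
rewrite /deg_proj bcoord_sum big_mkcond (bigD1 x) //= big1 => [|y y_x].
  by case: eqP => _; rewrite ?bcoordZ ?bcoord_bvec ?eqxx ?mulr1 addr0.
by case: eqP => // _; rewrite bcoordZ bcoord_bvec (negPf y_x) mulr0.
Qed.

(** The coordinates kept by the projection have degree [0], hence are constants, and membership in
    [m F] kills their constant terms. *)
Lemma deg_proj_mF j f : positive_grading w ->
  gF j f -> in_mF f -> deg_proj E j f = 0.
Proof.
move=> w_pos fj f_mF; rewrite /deg_proj big1 // => x /eqP xj.
by rewrite (bcoord_homC w_pos fj xj) (bcoord_in_mF _ f_mF) mpolyC0 scale0r.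
Qed.

Lemma deg_projB j f f' :
  deg_proj E j (f - f') = deg_proj E j f - deg_proj E j f'.
Proof.
by rewrite -sumrB; apply: eq_bigr => x _; rewrite bcoordB scalerBl.
Qed.

Lemma deg_proj_span j (c : bidx E -> R) :
  deg_proj E j (\sum_(y | bdeg y == j) c y *: bvec y) =
    \sum_(y | bdeg y == j) c y *: bvec y.
Proof.
apply: eq_bigr => x xj; rewrite bcoord_sum (bigD1 x) //=.
rewrite big1 => [|y /andP[_ y_x]].
  by rewrite bcoordZ bcoord_bvec eqxx mulr1 addr0.
by rewrite bcoordZ bcoord_bvec (negPf y_x) mulr0.
Qed.

(** Modulo [m] only constant terms of coordinates survive, and a coordinate on a basis vector of
    degree other than [j] is homogeneous of nonzero degree, so it has none. *)
Lemma pure_hom j f : gF j f ->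
  pure f = \sum_(x : bidx E | bdeg x == j)
             ((bcoord f x)@_0%MM)%:MP *: pure (bvec x).
Proof.
move=> fj; rewrite -{1}[f](bcoordK E) pure_sum [RHS]big_mkcond.
apply: eq_bigr => x _; case: ifPn => [_|xj].
  apply/eqP; rewrite pureZ -subr_eq0 -scalerBl -pureZ; apply/eqP/pure0P.
  by apply: in_mF_poly; rewrite mcoeffB mcoeffC eqxx mulr1 subrr.
by apply/pure0P/in_mF_poly/(bcoord_hom_mcoeff0 fj xj).
Qed.

End Coordinates.

End Graded.

(** * Independence of the trace from the basis, when the subspace divided out is zero *)

Section TraceUniqueness.

Variables (k : fieldType) (n : nat).
Local Notation R := {mpoly k[n]}.
Variables (T : lmodType R) (V W : T -> Prop) (phi : T -> T).
Hypothesis W0 : forall t, W t <-> t = 0.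
Hypothesis phi_comb : forall N (c : 'I_N -> k) (v : 'I_N -> T),
  phi (\sum_a (c a)%:MP *: v a) = \sum_a (c a)%:MP *: phi (v a).

Definition comb (N : nat) (v : 'I_N -> T) (c : 'I_N -> k) : T :=
  \sum_a (c a)%:MP *: v a.

Lemma comb_inj N (v : 'I_N -> T) (c c' : 'I_N -> k) : is_basis_mod V W v ->
  V (comb v c) -> comb v c = comb v c' -> c =1 c'.
Proof.
case=> _ v_uniq /v_uniq[c0 [_ c0_uniq]] cc' a.
have rowE (b : 'I_N -> k) : comb v c = comb v b -> c0 = \row_a b a.
  move=> cb; apply: c0_uniq; apply/W0; rewrite cb; apply/eqP; rewrite subr_eq0.
  by apply/eqP/eq_bigr => a' _; rewrite mxE.
have := rowE c' cc'; rewrite (rowE c erefl) => /matrixP/(_ 0 a).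
by rewrite !mxE.
Qed.

(** Column [b] of [P] holds the coordinates of [v' b]. The two sizes are kept distinct, since
    nothing yet says that two bases have the same cardinality. *)
Lemma basis_mod_change N N' (v : 'I_N -> T) (v' : 'I_N' -> T) :
    is_basis_mod V W v -> (forall b, V (v' b)) ->
  exists P : 'M[k]_(N, N'), forall b, v' b = comb v (P ^~ b).
Proof.
case=> _ v_uniq v'V.
have /choice[c cE] b : exists c : 'rV[k]_N, v' b = comb v (c 0).
  have [c [/W0/eqP]] := v_uniq _ (v'V b).
  by rewrite subr_eq0 => /eqP ? _; exists c.
exists (\matrix_(a, b) c b 0 a) => b; rewrite cE.
by apply: eq_bigr => a _; rewrite mxE.
Qed.

Lemma comb_mulmx N N' p (v : 'I_N -> T) (P : 'M[k]_(N, N'))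
    (Q : 'M[k]_(N', p)) a :
  \sum_b (Q b a)%:MP *: comb v (P ^~ b) = comb v ((P *m Q) ^~ a).
Proof.
under eq_bigr do rewrite scaler_sumr.
rewrite exchange_big /=; apply: eq_bigr => c _; rewrite mxE.
rewrite (raddf_sum (@mpolyC n k)) scaler_suml; apply: eq_bigr => b _.
by rewrite scalerA -mpolyCM mulrC.
Qed.

Lemma basis_mod_changeK N N' (v : 'I_N -> T) (v' : 'I_N' -> T)
    (P : 'M[k]_(N, N')) (Q : 'M[k]_(N', N)) :
    is_basis_mod V W v -> (forall b, v' b = comb v (P ^~ b)) ->
    (forall a, v a = comb v' (Q ^~ a)) ->
  P *m Q = 1%:M.
Proof.
move=> v_basis PE QE.
have idE a : v a = comb v ((1%:M : 'M_N) ^~ a).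
  rewrite /comb (bigD1 a) //= mxE eqxx mpolyC1 scale1r big1 ?addr0 // => b ba.
  by rewrite mxE (negPf ba) mpolyC0 scale0r.
apply/matrixP => b a; apply/esym; move: b; apply: (comb_inj v_basis).
  by rewrite -idE; case: v_basis.
by rewrite -idE {1}QE -comb_mulmx; apply: eq_bigr => b _; rewrite -PE.
Qed.

(** The base changes [P] and [Q] are mutually inverse and intertwine the two matrices of [phi], so
    [\tr A = \tr (A *m P *m Q) = \tr (P *m A' *m Q) = \tr A']. *)
Lemma is_trace_mod_uniq t t' :
  (forall x, V x -> V (phi x)) ->
  is_trace_mod V W phi t -> is_trace_mod V W phi t' -> t = t'.
Proof.
move=> phiV [N [v [A [v_basis vA ->]]]] [N' [v' [A' [v'_basis v'A' ->]]]].
have [[vV _] [v'V _]] := (v_basis, v'_basis).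
have [P PE] := basis_mod_change v_basis v'V.
have [Q QE] := basis_mod_change v'_basis vV.
have {}vA a : phi (v a) = comb v (A ^~ a).
  by apply/eqP; rewrite -subr_eq0; apply/eqP/W0/vA.
have {}v'A' b : phi (v' b) = comb v' (A' ^~ b).
  by apply/eqP; rewrite -subr_eq0; apply/eqP/W0/v'A'.
have PQ := basis_mod_changeK v_basis PE QE.
have QP := basis_mod_changeK v'_basis QE PE.
(* Column [b] of either side consists of the coordinates of [phi (v' b)] in the basis [v]. *)
have PA : P *m A' = A *m P.
  apply/matrixP => a b; move: a; apply: (comb_inj v_basis).
    rewrite -comb_mulmx; under eq_bigr do rewrite -PE.
    by rewrite -[X in V X]v'A'; apply/phiV.
  rewrite -!comb_mulmx; under eq_bigr do rewrite -PE.
  under [RHS]eq_bigr do rewrite -vA.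
  by rewrite -phi_comb -[LHS]v'A' {1}PE.
by rewrite -[A]mulmx1 -PQ mulmxA -PA mxtrace_mulC mulmxA QP mul1mx.
Qed.

Lemma trace_modE t :
  (forall x, V x -> V (phi x)) -> is_trace_mod V W phi t ->
  trace_mod V W phi = t.
Proof.
move=> phiV t_tr; rewrite /trace_mod; case: pselect => [e|[]]; last by exists t.
by apply: is_trace_mod_uniq phiV _ t_tr; apply: (svalP (cid e)).
Qed.

End TraceUniqueness.

(** * Compatible actions on a free module and on its reduction modulo [m] *)

Section Equivariance.

Variables (k : fieldType) (n r : nat) (w : 'I_n -> 'rV[int]_r).
Variable gT : finGroupType.
Local Notation R := {mpoly k[n]}.
Variable actR : gT -> R -> R.
Hypothesis w_positive : positive_grading w.
Hypothesis actR_action : ring_action w actR.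

(** The image of a variable stays homogeneous of degree [w i], which is nonzero because [L] is
    positive on it. Hence the action preserves [m]. *)
Lemma actR_X_mcoeff0 g i : (actR g 'X_i)@_0%MM = 0.
Proof.
apply: (poly_homog_mcoeff0 (ract_deg actR_action (@poly_homogX k n r w i))).
have [L Lw] := w_positive; apply: contraTneq (Lw i) => ->.
by rewrite raddf0 ltxx.
Qed.

Variables (F : lmodType R) (gF : grading w F) (act : gT -> F -> F).
Hypothesis act_action : module_action actR gF act.

Lemma mactD g x y : act g (x + y) = act g x + act g y.
Proof.
by have := mact_linear act_action g 1 x y; rewrite mpolyC1 !scale1r.
Qed.

Lemma mact0 g : act g 0 = 0.
Proof. by apply: (addrI (act g 0)); rewrite -mactD !addr0. Qed.

Lemma mact_scaleC g (c : k) x : act g (c%:MP *: x) = c%:MP *: act g x.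
Proof.
by rewrite -[c%:MP *: x]addr0 (mact_linear act_action) mact0 addr0.
Qed.

Lemma mactB g x y : act g (x - y) = act g x - act g y.
Proof.
rewrite mactD; congr (_ + _).
have N1 (z : F) : - z = (-1)%:MP *: z by rewrite mpolyCN mpolyC1 scaleN1r.
by rewrite N1 mact_scaleC -N1.
Qed.

Lemma mact_sum g (I : Type) (s : seq I) (P : pred I) (x : I -> F) :
  act g (\sum_(a <- s | P a) x a) = \sum_(a <- s | P a) act g (x a).
Proof. exact: (big_morph _ (mactD g) (mact0 g)). Qed.

Lemma mact_mF g f : in_mF f -> in_mF (act g f).
Proof.
case=> h ->; rewrite mact_sum; apply: in_mF_sum => i _.
by rewrite (mactZ act_action); apply/in_mF_poly/actR_X_mcoeff0.
Qed.

Lemma tensk_map_mact g f : tensk_map (act g) (pure f) = pure (act g f).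
Proof. by apply: tensk_mapE => [x y|]; [apply: mactB | apply: mact_mF]. Qed.

Lemma tensk_map_mact_comb g N (c : 'I_N -> k) (v : 'I_N -> tensk F) :
  tensk_map (act g) (\sum_a (c a)%:MP *: v a) =
  \sum_a (c a)%:MP *: tensk_map (act g) (v a).
Proof.
have /choice[f fE] a : exists f, v a = pure f.
  by exists (generic_quotient.repr (v a)); rewrite pure_repr.
under eq_bigr do rewrite fE -pureZ.
rewrite -pure_sum tensk_map_mact mact_sum pure_sum; apply: eq_bigr => a _.
by rewrite fE tensk_map_mact mact_scaleC pureZ.
Qed.

Variable E : hom_basis gF.
Hypothesis E_stable : basis_stable E act.

(** The map [act g] is only semilinear over [R], but it agrees with its linear extension on
    [k]-combinations of basis vectors, and stability says that [act h (bvec x)] is one. This gives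
    the multiplicativity of [psi] in the group element. *)
Lemma lin_ext_mact g h (x : bidx E) :
  lin_ext (fun y : bidx E => act g (bvec y)) (act h (bvec x)) =
  act (g * h)%g (bvec x).
Proof.
rewrite (mactA act_action); have [c ->] := E_stable h x.
rewrite linear_sum mact_sum; apply: eq_bigr => y _.
by rewrite linearZ /= lin_ext_bvec mact_scaleC.
Qed.

Lemma lin_ext_mactK g h : (g * h = 1)%g ->
  cancel (lin_ext (fun x : bidx E => act h (bvec x)))
         (lin_ext (fun x : bidx E => act g (bvec x))).
Proof.
move=> gh1; pose u := lin_ext (fun x : bidx E => act g (bvec x)).
pose v := lin_ext (fun x : bidx E => act h (bvec x)).
apply: (linear_ext (B := E) (u := u \o v) (v := idfun)) => x /=.
by rewrite /v lin_ext_bvec /u lin_ext_mact gh1 (mact1 act_action).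
Qed.

Lemma deg_proj_mact g j (x : bidx E) :
  bdeg x = j -> deg_proj E j (act g (bvec x)) = act g (bvec x).
Proof. by move<-; have [c ->] := E_stable g x; apply: deg_proj_span. Qed.

End Equivariance.

(** * The Betti character as a trace on [F / m F] *)

Section BettiCharacter.

Variables (k : fieldType) (n r : nat) (w : 'I_n -> 'rV[int]_r).
Variable gT : finGroupType.
Local Notation R := {mpoly k[n]}.
Variable actR : gT -> R -> R.
Hypothesis w_positive : positive_grading w.
Hypothesis actR_action : ring_action w actR.
Variables (F : nat -> lmodType R) (gF : forall i, grading w (F i)).
Variable d : forall i, {linear F i.+1 -> F i}.
Hypothesis d_minimal : forall i f, in_mF (d i f).
Variable actF : forall i, gT -> F i -> F i.
Arguments actF : clear implicits.
Hypothesis actF_action : forall i, module_action actR (gF i) (actF i).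

Lemma tensk_map_minimal i t : tensk_map (d i) t = 0.
Proof. exact/pure0P. Qed.

(** By minimality the differentials become zero after tensoring with [k]. *)
Lemma tor_boundaryP i j t : tor_boundary gF d (i := i) j t <-> t = 0.
Proof.
split=> [[_ [u ->]]|->]; first exact: tensk_map_minimal.
split; first by exists 0; rewrite pure0; split=> //; apply: hom_part0.
by exists 0; rewrite tensk_map_minimal.
Qed.

Lemma tor_cycleP i j t : tor_cycle gF d (i := i) j t <-> tensk_hom gF j t.
Proof.
by case: i t => [|i] t; split=> [[]|] //; split=> //; apply: tensk_map_minimal.
Qed.

Variables (i : nat) (E : hom_basis (gF i)).

(** The classes of the basis vectors of degree [j] form a [k]-basis of the homology in that degree;
    coordinates there are constant terms of coordinates in [F i], so the sum is the trace of the
    matrix [A]. *)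
Lemma betti_characterE j g :
  betti_character gF d actF i j g =
  \sum_(x : bidx E | bdeg x == j) (bcoord (actF i g (bvec x)) x)@_0%MM.
Proof.
pose X := [pred x : bidx E | bdeg x == j].
pose e (a : 'I_#|X|) : bidx E := enum_val a.
have e_deg a : bdeg (e a) = j by apply/eqP; apply: (enum_valP a).
have sumX (V : nmodType) (f : bidx E -> V) :
    \sum_(x | bdeg x == j) f x = \sum_a f (e a) by exact: big_enum_val.
pose A := \matrix_(b, a) (bcoord (actF i g (bvec (e a))) (e b))@_0%MM.
pose v a := pure (bvec (e a)).
have act_deg f : gF i j f -> gF i j (actF i g f).
  exact: (mact_deg (actF_action i)).
have v_deg a : gF i j (bvec (e a)) by rewrite -(e_deg a); apply: bdegP.
have -> : \sum_(x : bidx E | bdeg x == j) (bcoord (actF i g (bvec x)) x)@_0%MM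
    = \tr A by rewrite sumX; apply: eq_bigr => a _; rewrite mxE.
apply: trace_modE.
- by move=> t; apply: tor_boundaryP.
- exact: (tensk_map_mact_comb w_positive actR_action (actF_action i)).
- move=> t /tor_cycleP[f [fj ->]]; apply/tor_cycleP.
  exists (actF i g f); split; first exact: act_deg.
  exact: (tensk_map_mact w_positive actR_action (actF_action i)).
exists #|X|, v, A; split=> //.
  split=> [a|t /tor_cycleP[f [fj ->]]].
    by apply/tor_cycleP; exists (bvec (e a)).
  exists (\row_a (bcoord f (e a))@_0%MM); split.
    apply/tor_boundaryP; rewrite (pure_hom E fj) sumX -sumrB big1 // => a _.
    by rewrite mxE subrr.
  (* Uniqueness: the difference of [f] and the combination lies in [m F], so the constant term of
     its coordinate at [e a] is zero. *)
  move=> c /tor_boundaryP; under eq_bigr do rewrite -pureZ.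
  rewrite -pure_sum -pureB => /pure0P f_mF; apply/rowP => a; rewrite mxE.
  have := bcoord_in_mF (e a) f_mF; rewrite bcoordB bcoord_sum mcoeffB.
  rewrite (bigD1 a) //= big1 => [|b b_a]; rewrite bcoordZ bcoord_bvec.
    rewrite eqxx mulr1 addr0 mcoeffC eqxx mulr1 => /eqP.
    by rewrite subr_eq0 => /eqP.
  by rewrite (inj_eq enum_val_inj) (negPf b_a) mulr0.
move=> a; apply/tor_boundaryP.
rewrite (tensk_map_mact w_positive actR_action (actF_action i)).
rewrite (pure_hom E (act_deg _ (v_deg a))) sumX -sumrB big1 // => b _.
by rewrite mxE subrr.
Qed.

End BettiCharacter.

(** * Comparison of [psihat] with [psi] *)

Theorem theorem2p2 (k : fieldType) (n r : nat) (w : 'I_n -> 'rV[int]_r)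
  (w_positive : positive_grading w)
  (gT : finGroupType)
  (char_ndvd : forall p : nat, p \in [pchar k] -> ~~ (p %| #|gT|)%N)
  (actR : gT -> {mpoly k[n]} -> {mpoly k[n]})
  (actR_action : ring_action w actR)
  (M : lmodType {mpoly k[n]}) (gM : grading w M)
  (M_fg : fin_generated M)
  (actM : gT -> M -> M)
  (actM_action : module_action actR gM actM)
  (F : nat -> lmodType {mpoly k[n]}) (gF : forall i, grading w (F i))
  (d : forall i, {linear F i.+1 -> F i}) (eps : {linear F 0%N -> M})
  (F_res : minimal_resolution gM gF d eps)
  (actF : forall i, gT -> F i -> F i)
  (actF_action : forall i, module_action actR (gF i) (actF i))
  (d_equivariant : forall i g f, d i (actF i.+1 g f) = actF i g (d i f))
  (eps_equivariant : forall g f, eps (actF 0%N g f) = actM g (eps f))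
  (E : forall i, hom_basis (gF i))
  (E_stable : forall i, basis_stable (E i) (actF i))
  (g : gT)
  (psihat : forall i, {linear F i -> F i})
  (psihat_deg : forall i, degree_preserving (gF i) (gF i) (psihat i))
  (psihat_complex : forall i f,
    psihat i (d i f) = twisted_d d E actF g i (psihat i.+1 f))
  (psihat0 : forall f, psihat 0%N f = psi E actF g 0%N f) :
  (forall (i : nat) (j : 'rV[int]_r) (e : bidx (E i)), bdeg e = j ->
     deg_proj (E i) j (psihat i (bvec e)) = actF i g (bvec e) /\
     actF i g (bvec e) = psi E actF g i (bvec e)) /\
  (forall (i : nat) (j : 'rV[int]_r),
     (betti_character gF d actF i j g)%:MP = deg_trace (E i) j (psihat i)).
Proof.
have [_ _ _ exact0 exactS d_minimal] := F_res.
(* The maps [psi] for all group elements, packaged as linear maps; the inverse of [u i g] is then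
   the linear map [u i g^-1]. *)
pose u i h : {linear F i -> F i} :=
  lin_ext (fun x : bidx (E i) => actF i h (bvec x)).
have uE i f : psi E actF g i f = u i g f by [].
have uK i h h' : (h * h' = 1)%g -> cancel (u i h') (u i h).
  exact: (lin_ext_mactK (actF_action i) (E_stable i)).
have uV i : cancel (u i g^-1%g) (u i g) by apply: uK; rewrite mulgV.
have Vu i : cancel (u i g) (u i g^-1%g) by apply: uK; rewrite mulVg.
have psiV i f : inverse_map (psi E actF g i) f = u i g^-1%g f.
  apply: (can_inj (Vu i)); rewrite uV.
  have [_] := @inverse_mapP (F i) (F i) (psi E actF g i)
    (Bijective (Vu i : cancel (psi E actF g i) _) (uV i)).
  exact.
pose th i : {linear F i -> F i} := u i g^-1%g \o psihat i.
(* The outer factor [psi] of the twisted differential cancels against [u i g^-1], and its inner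
   inverse combines with [psihat] into [th i.+1]. *)
have th_chain i f : th i (d i f) = d i (th i.+1 f).
  by rewrite /th /= psihat_complex /twisted_d /= uE Vu psiV.
have th_mod_m i f : in_mF (th i f - f).
  apply: (lift_id_mod_m _ exact0 exactS d_minimal th_chain).
    by move=> i'; constructor; apply: hbasis (E i').
  by move=> f'; rewrite /th /= psihat0 uE Vu.
have proj_psihat i j (e : bidx (E i)) : bdeg e = j ->
    deg_proj (E i) j (psihat i (bvec e)) = actF i g (bvec e).
  move=> ej; rewrite -(deg_proj_mact (E_stable i) g ej); apply/eqP.
  have ge : actF i g (bvec e) = u i g (bvec e) by rewrite /u /= lin_ext_bvec.
  rewrite -subr_eq0 -deg_projB; apply/eqP/deg_proj_mF => //.
    have e_j : gF i j (bvec e) by rewrite -ej; apply: bdegP.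
    apply: hom_partB; first exact: psihat_deg.
    exact: (mact_deg (actF_action i)).
  (* The difference is the image under [u i g] of [th i (bvec e) - bvec e], and linear maps preserve
     [m F]. *)
  by rewrite ge -[psihat i _](uV i) -linearB; apply/in_mF_linear/th_mod_m.
split=> [i j e ej|i j].
  by split; [apply: proj_psihat | rewrite uE /u /= lin_ext_bvec].
rewrite (betti_characterE w_positive actR_action d_minimal actF_action (E i)).
rewrite /deg_trace (raddf_sum (@mpolyC n k)) /=; apply: eq_bigr => e /eqP ej.
have e_j : gF i j (bvec e) by rewrite -ej; apply: bdegP.
(* The diagonal coordinate of [actF i g (bvec e)] has degree [0], so it equals its constant term;
   the projection to degree [j] leaves this coordinate unchanged. *)
rewrite -(bcoord_homC w_positive _ ej); last exact: (mact_deg (actF_action i)).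
by rewrite -(proj_psihat i j e ej) bcoord_deg_proj ej eqxx.
Qed.
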